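(* Let $n,k$ be integers with $n\ge 2$ and $n-1\ge k\ge 1$. Let $D_{n+1,k-1}$ be the number of dissections of a convex polygon with $n+1$ labelled edges by $k-1$ diagonals such that no two of the diagonals intersect in their interior. Then $$D_{n+1,k-1}=\frac{1}{k}\binom{n-2}{k-1}\binom{n+k-1}{k-1}.$$
   Context: A dissection of a convex polygon with $n+1$ labelled edges by $k-1$ diagonals is a set of $k-1$ distinct diagonals (segments joining two non-adjacent vertices) no two of which intersect in their interiors. Since the edges are labelled, the polygon is fixed and dissections differing by a rotation or reflection are counted as different. *)

(* Defs.v *)
From HB Require Import structures.
From mathcomp Require Import all_boot all_order all_algebra.
From mathcomp Require Import boolp classical_sets reals.

Set Implicit Arguments.
Unset Strict Implicit.
Unset Printing Implicit Defensive.

Import Order.TTheory GRing.Theory Num.Theory.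
Local Open Scope ring_scope.

(* Positive iff a, b, c is a counterclockwise triple; zero iff they are
   collinear. *)
Definition orient (R : realType) (a b c : 'rV[R]_2) : R :=
  (b 0 0 - a 0 0) * (c 0 1 - a 0 1) - (b 0 1 - a 0 1) * (c 0 0 - a 0 0).

(* The vertices are p 0, ..., p (N - 1) in cyclic order and edge i joins p i to
   p (ordS i). The polygon is convex when, for each edge, all the other vertices
   lie strictly on one side of its line, the same for all of them (j = k gives
   strictness). Either orientation of the boundary is allowed. *)
Definition convex_polygon (R : realType) (N : nat) (p : 'I_N -> 'rV[R]_2) : Prop :=
  forall i j k : 'I_N,
    j != i -> j != ordS i -> k != i -> k != ordS i ->
    0 < orient (p i) (p (ordS i)) (p j) * orient (p i) (p (ordS i)) (p k).

Definition adjacent (N : nat) (i j : 'I_N) : bool :=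
  (j == ordS i) || (i == ordS j).

(* A diagonal is encoded by the set of its two endpoints. *)
Definition diagonals (N : nat) : {set {set 'I_N}} :=
  [set d : {set 'I_N} |
    [exists i, exists j, [&& i != j, ~~ adjacent i j & d == [set i; j]]]].

Definition diagonal_interior (R : realType) (N : nat) (p : 'I_N -> 'rV[R]_2)
    (d : {set 'I_N}) : classical_sets.set 'rV[R]_2 :=
  [set x | exists (i j : 'I_N) (t : R),
     [/\ d = [set i; j]%SET, 0 < t < 1 & x = (1 - t) *: p i + t *: p j]]%classic.

Definition dissections (R : realType) (N : nat) (p : 'I_N -> 'rV[R]_2) (m : nat) :
    {set {set {set 'I_N}}} :=
  [set S : {set {set 'I_N}} |
    [&& S \subset diagonals N, #|S| == m &
        [forall d in S, forall e in S, (d != e) ==>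
           `[< (diagonal_interior p d `&` diagonal_interior p e = set0)%classic >]]]].

(* Main.v *)
(* Noncrossing sets of chords on the vertices 0..l are refined by the number of
   visible vertices, those lying under no chord. If l is visible in such a set on
   0..l+1, the set lives on 0..l. Otherwise the longest chord ending at l+1 starts
   at the second to last visible vertex; removing it uncovers further vertices, and
   the chord can be recovered from the rest together with the original number of
   visible vertices. This gives a recurrence with a hypergeometric solution. A set
   avoids the base edge {0, n} iff more than two vertices are visible.

   Geometrically, strict convexity makes all triples i < j < k equally oriented (a
   Pluecker relation propagates this along the boundary), so two chords have
   disjoint interiors iff their endpoints do not interleave. *)

Require Import Defs.
From HB Require Import structures.
From mathcomp Require Import boolp classical_sets reals.
From mathcomp Require Import all_boot all_order all_algebra.
From mathcomp Require Import zify ring lra.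

Set Implicit Arguments.
Unset Strict Implicit.
Unset Printing Implicit Defensive.

Import Order.TTheory GRing.Theory Num.Theory.

(** * Noncrossing chord sets and their visible vertices *)

Section Chords.
Local Open Scope nat_scope.
Variable N : nat.
Local Notation chord := ('I_N * 'I_N)%type.
Implicit Types (c d : chord) (S : {set chord}) (v : 'I_N) (r l k : nat).

(** Asymmetric: only the case where [c] starts first. Quantifying over all ordered pairs, as
    [noncrossing] does, covers the other case. *)
Definition crossing c d : bool := (c.1 < d.1 < c.2) && (c.2 < d.2).

Definition visible S v : bool := [forall c in S, ~~ (c.1 < v < c.2)].

Definition visibles l S : {set 'I_N} := [set v : 'I_N | (v <= l) && visible S v].

(** Chords are stored with the smaller end first and hide at least one vertex, so sides between
    consecutive vertices are excluded; the chord from [0] to [l] is allowed. *)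
Definition noncrossing l S : bool :=
  [forall c in S, c.1.+1 < c.2 <= l] &&
  [forall c in S, forall d in S, ~~ crossing c d].

Definition families l k : {set {set chord}} :=
  [set S : {set chord} | noncrossing l S & #|S| == k].

(** A tail count, because removing a chord leaves only a lower bound on the number of visible
    vertices. [N] stays fixed while [l] varies, so that families for different [l] share a type. *)
Definition nfam r l k : nat := #|[set S in families l k | r < #|visibles l S|]|.

Lemma visibleP S v :
  reflect (forall c, c \in S -> ~~ (c.1 < v < c.2)) (visible S v).
Proof. exact: forall_inP. Qed.

Lemma noncrossingP l S :
  reflect ((forall c, c \in S -> c.1.+1 < c.2 <= l) /\
           (forall c d, c \in S -> d \in S -> ~~ crossing c d))
          (noncrossing l S).
Proof.
apply: (iffP andP) => -[h1 h2]; split; try exact/forall_inP.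
  by move=> c d cS dS; apply: (forall_inP (forall_inP h2 _ cS)).
by apply/forall_inP => c cS; apply/forall_inP => d dS; exact: h2.
Qed.

Lemma visible0 S (v : 'I_N) : v = 0 :> nat -> visible S v.
Proof. by move=> v0; apply/visibleP => c _; rewrite v0. Qed.

Lemma visible_end l S (v : 'I_N) : noncrossing l S -> l <= v -> visible S v.
Proof. by move=> /noncrossingP[h _] lv; apply/visibleP => c /h; lia. Qed.

Lemma card_ord_leq l : l < N -> #|[set v : 'I_N | v <= l]| = l.+1.
Proof.
move=> lN; have winj : injective (widen_ord lN) by move=> i j /(congr1 val) /= /val_inj.
rewrite -[RHS]card_ord -(card_imset _ winj).
apply: eq_card => v; rewrite inE; apply/idP/imsetP => [vl|[w _ ->] /=]; last by rewrite -ltnS.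
by rewrite -ltnS in vl; exists (Ordinal vl) => //; apply: val_inj.
Qed.

Lemma visibles_sub l S : visibles l S \subset [set v : 'I_N | v <= l].
Proof. by apply/subsetP => v; rewrite !inE => /andP[]. Qed.

Lemma nfam0 r l : l < N -> nfam r l 0 = (r <= l).
Proof.
move=> lN; rewrite /nfam.
have vl : visibles l set0 = [set v : 'I_N | v <= l].
  by apply/setP => v; rewrite !inE; case: leqP => //= _; apply/visibleP => c; rewrite inE.
have nc : noncrossing l set0.
  by apply/noncrossingP; split=> [c|c d]; rewrite inE.
have -> : [set S in families l 0 | r < #|visibles l S|] = if r <= l then [set set0] else set0.
  apply/setP => S; rewrite !inE cards_eq0; case: (S =P set0) => [->|/eqP Sn].
    by rewrite nc vl card_ord_leq // ltnS; case: (leqP r l) => _; rewrite ?in_set1 ?in_set0 ?eqxx.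
  by rewrite andbF; case: (leqP r l) => _; rewrite ?in_set1 ?in_set0 ?(negbTE Sn).
by case: (leqP r l); rewrite ?cards1 ?cards0.
Qed.

(** Any chord hides the vertex just after its left end, so the [l + 1] vertices are never all
    visible. *)
Lemma nfam_top l k : l < N -> nfam l l k.+1 = 0.
Proof.
move=> lN; apply/eqP; rewrite cards_eq0 -subset0; apply/subsetP => S.
rewrite !inE => /andP[/andP[/noncrossingP[nc _] /eqP cS] hv].
have /card_gt0P[[i j] cin] : 0 < #|S| by rewrite cS.
have /= := nc _ cin; have := ltn_ord j => jN hij.
have /eqP E : visibles l S == [set v : 'I_N | v <= l].
  by rewrite eqEcard visibles_sub card_ord_leq.
have h : i.+1 < N by lia.
have : Ordinal h \in visibles l S by rewrite E inE /=; lia.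
by rewrite inE => /andP[_ /visibleP/(_ _ cin) /=]; lia.
Qed.

Lemma nfam1 r k : 1 < N -> nfam r 1 k.+1 = 0.
Proof.
move=> lN; apply/eqP; rewrite cards_eq0 -subset0; apply/subsetP => S.
rewrite !inE => /andP[/andP[/noncrossingP[nc _] /eqP cS] _].
have /card_gt0P[[i j] cin] : 0 < #|S| by rewrite cS.
by have /= := nc _ cin; lia.
Qed.

Lemma card_visibles_gt1 l S : 0 < l < N -> noncrossing l S -> 1 < #|visibles l S|.
Proof.
case/andP => l0 lN nc.
have N0 : 0 < N by lia.
have /subset_leq_card : [set Ordinal N0; Ordinal lN] \subset visibles l S.
  apply/subsetP => v /set2P[->|->]; rewrite inE /=; first by rewrite visible0.
  by rewrite leqnn (visible_end nc).
by rewrite cards2; case: eqP => // -[]; lia.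
Qed.

(** Vertices [0] and [l] are distinct and always visible. *)
Lemma nfam_eq01 l k : 0 < l < N -> nfam 0 l k = nfam 1 l k.
Proof.
move=> lN; apply: eq_card => S; rewrite !inE; case nc: (noncrossing l S) => //=.
by have := card_visibles_gt1 lN nc; case: (_ == _) => //=; lia.
Qed.

(* The witness is [i + 1] or else the far end of the longest chord starting at [i]. *)
Lemma visible_between l S (i : 'I_N) (e : 'I_N) :
  noncrossing l S -> e = l :> nat -> visible S i -> i.+1 < l -> (i, e) \notin S ->
  exists2 v, visible S v & i < v < l.
Proof.
move=> /noncrossingP[nc1 nc2] el /visibleP vi il ieS.
have i1N : i.+1 < N by have := ltn_ord e; lia.
have [h|] := boolP (visible S (Ordinal i1N)); first by exists (Ordinal i1N) => //=; lia.
case/forall_inPn => -[j m] cS; rewrite negbK /= => ji.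
have ji' : j = i by apply: val_inj => /=; have /= := vi _ cS; lia.
rewrite {}ji' in cS.
case: (@arg_maxnP _ m (fun b => (i, b) \in S) (fun b => b) cS) => b ibS bmax {m cS ji}.
have /= hb := nc1 _ ibS.
have bl : b < l.
  rewrite ltn_neqAle -el; apply/andP; split; last by lia.
  by apply: contraNneq ieS => /val_inj <-.
exists b; last by lia.
apply/visibleP => -[j' m] cS; apply/negP => /= hc.
have [ji|ji|/val_inj ji] := ltngtP j' i.
- by have /= := vi _ cS; lia.
- by have := nc2 _ _ ibS cS; rewrite /crossing /=; lia.
by rewrite ji in cS; have := bmax _ cS; lia.
Qed.

(** The largest element of [A] has rank [#|A| - 1], and removing it leaves the other ranks
    unchanged. Ranks serve to recover the left end of a removed chord. *)
Lemma exists_rank (A : {set 'I_N}) q : q < #|A| ->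
  exists2 u, u \in A & #|[set v in A | v < u]| = q.
Proof.
elim: {A}_.+1 {-2}A (ltnSn #|A|) => // m IH A Am qA.
have /card_gt0P[u0 u0A] : 0 < #|A| by lia.
case: (@arg_maxnP _ u0 (fun v => v \in A) (fun b => b) u0A) => u uA umax.
have cA : #|A| = #|A :\ u|.+1 by rewrite (cardsD1 u) uA.
have below w : w \in A -> w <= u by move/umax.
have [qu|qu|qu] := ltngtP q #|A :\ u|; last 2 first.
- lia.
- exists u => //; rewrite qu; apply: eq_card => v; rewrite !inE andbC.
  case vA: (v \in A); rewrite ?andbF ?andbT //.
  by have := below _ vA; rewrite -val_eqE /=; lia.
have [||w wA <-] := IH (A :\ u); [lia|lia|].
move: wA; rewrite !inE => /andP[wu wA]; exists w => //.
apply: eq_card => v; rewrite !inE; case: (v =P u) => [->|//].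
by rewrite uA /=; have := below _ wA; lia.
Qed.

Lemma rank_inj (A : {set 'I_N}) u w : u \in A -> w \in A ->
  #|[set v in A | v < u]| = #|[set v in A | v < w]| -> u = w.
Proof.
wlog uw : u w / u <= w.
  by move=> H uA wA E; case: (leqP u w) => [/H|/ltnW/H h]; [exact|symmetry; exact: h].
move=> uA wA E; apply: val_inj => /=; apply/eqP; rewrite eqn_leq uw /= leqNgt.
apply/negP => lt; have : #|[set v in A | v < u]| < #|[set v in A | v < w]|.
  apply: proper_card; apply/properP; split.
    by apply/subsetP => v; rewrite !inE => /andP[->]; lia.
  by exists u; rewrite !inE ?uA //= ltnn.
by rewrite E ltnn.
Qed.

(** * Recurrence from removing the longest chord at the last vertex *)

Definition nfam_eq r l k : nat := #|[set S in families l k | #|visibles l S| == r.+1]|.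

Lemma nfam_split r l k : nfam r l k = nfam r.+1 l k + nfam_eq r l k.
Proof.
rewrite /nfam /nfam_eq -(cardsID [set S | r.+1 < #|visibles l S|]); congr (_ + _).
  by apply: eq_card => S; rewrite !inE; case: (noncrossing _ _ && _) => //=; lia.
by apply: eq_card => S; rewrite !inE; case: (noncrossing _ _ && _) => //=; rewrite ?andbF //; lia.
Qed.

Lemma visiblesS l S (e : 'I_N) : e = l.+1 :> nat -> visible S e ->
  visibles l.+1 S = e |: visibles l S.
Proof.
move=> el ve; apply/setP => v; rewrite !inE.
have [->|/eqP vne] := eqVneq v e; first by rewrite el leqnn ve.
by rewrite leq_eqVlt ltnS -el; case: eqP => // /val_inj.
Qed.

(** A chord ending at [l + 1] has length at least two and so hides [l]; visibility of [l] thus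
    confines the set to [0..l], and [l + 1] accounts for one extra visible vertex. *)
Lemma families_visible r l k (u : 'I_N) : l.+1 < N -> u = l :> nat ->
  [set S in families l.+1 k | (#|visibles l.+1 S| == r.+1) && visible S u] =
  [set S in families l k | #|visibles l S| == r].
Proof.
move=> lN ul; set e := Ordinal lN.
have step S : noncrossing l.+1 S -> (#|visibles l.+1 S| == r.+1) = (#|visibles l S| == r).
  move=> nc; rewrite (@visiblesS _ _ e) ?(visible_end nc) // cardsU1 inE.
  by rewrite /= ltnn.
apply/setP => S; rewrite !inE; apply/idP/idP.
  case/andP => /andP[nc ->] /andP[]; rewrite step // => -> vu.
  rewrite !andbT; case/noncrossingP: nc => nc1 nc2; apply/noncrossingP; split=> // c cS.
  by have := nc1 _ cS; have := visibleP _ _ vu _ cS; lia.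
case/andP => /andP[/[dup] nc /noncrossingP[nc1 nc2] ->] vr.
have nc' : noncrossing l.+1 S.
  by apply/noncrossingP; split=> // c /nc1; lia.
by rewrite nc' step // vr (visible_end nc) ?ul.
Qed.

Lemma visible_addchord S (i e v : 'I_N) :
  visible ((i, e) |: S) v = visible S v && ~~ (i < v < e).
Proof.
apply/visibleP/andP => [h|[/visibleP h hi] c /setU1P[->//|/h//]].
split; last by apply: (h (i, e)); rewrite setU11.
by apply/visibleP => c cS; apply: h; rewrite setU1r.
Qed.

(** The new chord hides everything strictly between its ends, so what stays visible is the part
    before [i] and the two ends. *)
Lemma card_visibles_addchord l S (i e : 'I_N) :
  noncrossing l S -> e = l :> nat -> visible S i -> i < e ->
  #|visibles l ((i, e) |: S)| = #|[set v in visibles l S | v < i]|.+2.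
Proof.
move=> nc el vi ie.
have ve : visible S e by rewrite (visible_end nc) ?el.
have -> : visibles l ((i, e) |: S) = e |: (i |: [set v in visibles l S | v < i]).
  apply/setP => v; rewrite !inE visible_addchord.
  have [->|ne] := eqVneq v e; first by rewrite el leqnn ve ltnn andbF.
  have [->|ni] := eqVneq v i; first by rewrite vi ltnn -el ltnW.
  move: ne ni; rewrite -!val_eqE /= el; case: (visible S v); rewrite ?andbF //=; lia.
rewrite !cardsU1 !inE.
have -> : (e == i) = false by rewrite -val_eqE gtn_eqF.
by rewrite ltnn andbF (ltnNge e) (ltnW ie) andbF.
Qed.

(** A chord hiding [l] must end at [l + 1]. The longest such chord has a visible left end: a chord
    over that end would cross it, or end at [l + 1] and be longer. *)
Lemma outer_chord l S (u e : 'I_N) :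
  noncrossing l.+1 S -> u = l :> nat -> e = l.+1 :> nat -> ~~ visible S u ->
  exists2 i, (i, e) \in S & visible S i.
Proof.
case/noncrossingP => nc1 nc2 ul el /forall_inPn[[i0 m] cS]; rewrite negbK /= => hu.
have me : m = e by apply: val_inj => /=; have /= := nc1 _ cS; lia.
rewrite {}me in cS.
case: (@arg_minnP _ i0 (fun i => (i, e) \in S) (fun i => i) cS) => i iS imin.
exists i => //; apply/visibleP => -[j m'] jS; apply/negP => /= hj.
have /= := nc1 _ jS; have /= := nc1 _ iS => h1 h2.
have [h|h] := ltnP m' e; first by have := nc2 _ _ jS iS; rewrite /crossing /=; lia.
have m'e : m' = e by apply: val_inj => /=; lia.
by rewrite m'e in jS; have := imin _ jS; lia.
Qed.

(** Visibility of [i] rules out crossings; the vertex [v] makes the chord long enough. *)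
Lemma noncrossing_addchord l S (i e v : 'I_N) :
  noncrossing l S -> e = l :> nat -> visible S i -> i < v < e ->
  noncrossing l ((i, e) |: S).
Proof.
case/noncrossingP => nc1 nc2 el /visibleP vi ive; apply/noncrossingP; split.
  by move=> c /setU1P[->/=|/nc1//]; lia.
move=> c d /setU1P[->|cS] /setU1P[->|dS]; rewrite /crossing /=; last exact: nc2.
- lia.
- by have := nc1 _ dS; lia.
by have := vi _ cS; lia.
Qed.

Lemma noncrossing_sub l S S' : S' \subset S -> noncrossing l S -> noncrossing l S'.
Proof.
move=> /subsetP sub /noncrossingP[nc1 nc2]; apply/noncrossingP; split=> [c /sub/nc1//|].
by move=> c d /sub cS /sub; exact: nc2.
Qed.

(** A bijection: removing the longest chord [(i, e)] leaves visible [r] vertices before [i], then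
    [i], [e] and at least one vertex in between, hence more than [r + 2]. Conversely, [i] is
    recovered as the visible vertex of rank [r]. *)
Lemma families_addchord r l k (u : 'I_N) : l.+1 < N -> u = l :> nat ->
  #|[set S in families l.+1 k.+1 | (#|visibles l.+1 S| == r.+2) && ~~ visible S u]|
  = nfam r.+2 l.+1 k.
Proof.
move=> lN ul; pose e := Ordinal lN.
have el : e = l.+1 :> nat by [].
(* At most one [i] qualifies, since the longest chord to [e] hides the left ends of the shorter
   ones. The default [S] is never reached on [A]. *)
pose f S := if [pick i | ((i, e) \in S) && visible S i] is Some i then S :\ (i, e) else S.
set A := [set S in families l.+1 k.+1 | _].
have fP S : S \in A -> exists i,
    [/\ (i, e) \in S /\ f S = S :\ (i, e), noncrossing l.+1 (f S), visible (f S) i,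
        i.+1 < l.+1 & #|[set v in visibles l.+1 (f S) | v < i]| = r].
  rewrite !inE => /andP[/andP[nc cS] /andP[/eqP cv nvu]].
  rewrite /f; case: pickP => [i /andP[iS vi]|no]; last first.
    by have [i iS vi] := outer_chord nc ul el nvu; have := no i; rewrite iS vi.
  have nc' : noncrossing l.+1 (S :\ (i, e)) by apply: noncrossing_sub nc; exact: subD1set.
  have [nc1 _] := noncrossingP _ _ nc.
  have ie : i.+1 < l.+1 by have /= := nc1 _ iS; lia.
  have vi' : visible (S :\ (i, e)) i.
    by move: vi; rewrite -{1}(setD1K iS) visible_addchord => /andP[].
  exists i; split=> //.
  have := card_visibles_addchord nc' el vi' (ltnW ie); rewrite setD1K // cv => -[]; done.
rewrite /nfam -(@card_in_imset _ _ f A); last first.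
  move=> S1 S2 /fP[i1 [[iS1 ->] nc1 v1 l1 r1]] /fP[i2 [[iS2 ->] nc2 v2 l2 r2]] E.
  (* Both left ends have rank [r] among the visible vertices of the same set. *)
  suff i12 : i1 = i2 by rewrite -(setD1K iS1) -(setD1K iS2) E i12.
  apply: (@rank_inj (visibles l.+1 (S1 :\ (i1, e)))); rewrite ?r1 ?E ?r2 // inE.
    by rewrite -E v1; lia.
  by rewrite v2; lia.
apply: eq_card => S'; apply/imsetP/idP.
  case=> S SA ->; have [i [[iS fE] nc vi il ri]] := fP _ SA.
  move: SA; rewrite !inE nc /= => /andP[/andP[ncS /eqP cS] /andP[/eqP cv _]].
  apply/andP; split; first by move: cS; rewrite (cardsD1 (i, e)) iS add1n fE => -[->].
  have inS' : (i, e) \notin f S by rewrite fE setD11.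
  (* This vertex becomes visible only once the chord is removed, which makes the inclusion of the
     visible sets strict. *)
  have [v vv iv] := visible_between nc el vi il inS'.
  rewrite -cv -{1}(setD1K iS) -fE; apply: proper_card; apply/properP; split.
    by apply/subsetP => w; rewrite !inE visible_addchord => /and3P[-> ->].
  by exists v; rewrite !inE ?vv ?visible_addchord ?el ?iv ?andbF //; lia.
rewrite !inE => /andP[/andP[nc /eqP cS'] hv].
have /exists_rank[i + ri] : r < #|visibles l.+1 S'| by lia.
rewrite inE => /andP[il vi].
(* Otherwise at most [r + 2] vertices would be visible: the [r] before [i], then [i] and [e]. *)
have [v /andP[vv iv]] : exists v : 'I_N, visible S' v && (i < v < e).
  apply/existsP; move: hv; apply: contraLR; rewrite negb_exists -leqNgt => /forallP h.
  have : visibles l.+1 S' \subset e |: (i |: [set v in visibles l.+1 S' | v < i]).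
    apply/subsetP => v; rewrite !inE => /andP[vl vv]; have := h v.
    by rewrite vl vv -!val_eqE /=; lia.
  move/subset_leq_card; rewrite !cardsU1 ri; case: (_ \notin _); case: (_ \notin _); lia.
have inS' : (i, e) \notin S'.
  by apply: contraTN vv => iS; apply/forall_inPn; exists (i, e) => //; rewrite negbK.
have ie : i < e by lia.
have nc' := noncrossing_addchord nc el vi iv.
have vi' : visible ((i, e) |: S') i by rewrite visible_addchord vi ltnn.
have SA : (i, e) |: S' \in A.
  rewrite !inE nc' cardsU1 inS' cS' eqxx (card_visibles_addchord nc el vi ie) ri eqxx /=.
  by rewrite visible_addchord ul negb_and negbK; apply/orP; right; move: iv ul; rewrite /e /=; lia.
exists ((i, e) |: S') => //.
have [j [[jS ->] _ vj jl rj]] := fP _ SA.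
(* Both [i] and [j] are visible left ends of chords to [e], so neither chord passes over the left
   end of the other. *)
have -> : j = i; last by rewrite setU1K.
have /visibleP Vj : visible ((i, e) |: S') j by rewrite -(setD1K jS) visible_addchord vj ltnn.
have {vi'} /visibleP Vi := vi'.
apply: val_inj => /=; have /= := Vj _ (setU11 _ _); have /= := Vi _ jS.
by move: ie jl; rewrite /e /=; clear; lia.
Qed.

(** The first term collects the sets in which [l] is visible, the second those in which it is
    hidden. *)
Lemma nfam_eq_rec r l k : l.+1 < N ->
  nfam_eq r.+1 l.+1 k.+1 = nfam_eq r l k.+1 + nfam r.+2 l.+1 k.
Proof.
move=> lN; pose u := Ordinal (ltnW lN); have ul : u = l :> nat by [].
rewrite -(families_addchord r k lN ul) /nfam_eq -(families_visible r.+1 k.+1 lN ul).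
rewrite -(cardsID [set S | visible S u]); congr (_ + _).
  by apply: eq_card => S; rewrite !inE -!andbA.
by apply: eq_card => S; rewrite !inE andbC -!andbA.
Qed.

(** Exact counts are differences of consecutive tail counts; the terms are arranged so that nothing
    is subtracted in [nat]. *)
Lemma nfam_rec r l k : l.+1 < N ->
  nfam r.+1 l.+1 k.+1 + nfam r.+1 l k.+1 =
  nfam r.+2 l.+1 k.+1 + nfam r l k.+1 + nfam r.+2 l.+1 k.
Proof.
move=> lN; have := nfam_eq_rec r k lN.
by rewrite (nfam_split r.+1 l.+1) (nfam_split r l); lia.
Qed.

End Chords.

(** * Closed form of the recurrence *)

Section ClosedForm.
Local Open Scope ring_scope.

(* By the cycle lemma there are [j / k * 'C(n - j - 1, k - 1) * 'C(n + k - 1, k - 1)]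
   Schroeder forests with [j] trees, [n] leaves and [k] inner nodes; this closed form is
   the sum of these numbers over [j >= r], with [n = l + 1]. *)
Definition nfam_formula (r l k : nat) : rat :=
  'C(l.+1 - r, k)%:R * 'C(l + k, k)%:R * (l.+1%:R + (r%:R - 1) * k%:R)
    / (l.+1%:R * k.+1%:R).

(** Together with [bin_leftE], this brings binomials to common ones and leaves identities of
    rational functions. *)
Lemma bin_upE (n m : nat) : 'C(n.+1, m.+1)%:R = n.+1%:R / m.+1%:R * 'C(n, m)%:R :> rat.
Proof.
have : (n.+1 * 'C(n, m))%:R = (m.+1 * 'C(n.+1, m.+1))%:R :> rat by rewrite mul_bin_diag.
rewrite !natrM => h; apply: (@mulfI _ m.+1%:R); first by rewrite pnatr_eq0.
by rewrite -h mulrA mulrCA divff ?pnatr_eq0 // mulr1.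
Qed.

(** Valid for [n < m] too: truncated and true differences then disagree, but ['C(n, m)] vanishes. *)
Lemma bin_leftE (n m : nat) : 'C(n, m.+1)%:R = (n%:R - m%:R) / m.+1%:R * 'C(n, m)%:R :> rat.
Proof.
have : (m.+1 * 'C(n, m.+1))%:R = ((n - m) * 'C(n, m))%:R :> rat by rewrite mul_bin_left.
rewrite !natrM => h; apply: (@mulfI _ m.+1%:R); first by rewrite pnatr_eq0.
rewrite h mulrA mulrCA divff ?pnatr_eq0 // mulr1.
have [mn|nm] := leqP m n; first by rewrite natrB.
by rewrite bin_small // !mulr0.
Qed.

Lemma nfam_formula01 l k : nfam_formula 0 l k.+1 = nfam_formula 1 l k.+1.
Proof.
rewrite /nfam_formula subn0 subSS subn0 (bin_upE l k) (bin_leftE l k) -!natr1.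
by field; rewrite !natr1 !pnatr_eq0.
Qed.

Lemma nfam_formula_rec r l k : (r <= l)%N ->
  nfam_formula r.+1 l.+1 k.+1 + nfam_formula r.+1 l k.+1 =
  nfam_formula r.+2 l.+1 k.+1 + nfam_formula r l k.+1 + nfam_formula r.+2 l.+1 k.
Proof.
move=> rl; rewrite /nfam_formula !subSS (subSn rl); set a := (l - r)%N.
(* Every binomial now becomes a rational multiple of ['C(a, k)] or ['C(a + r + k + 1, k)]. *)
have -> : l = (a + r)%N by rewrite subnK.
rewrite (bin_upE a k) (bin_leftE a k) !addSn !addnS (bin_upE _ k) (bin_leftE _ k).
rewrite -!natr1 !natrD.
by field; rewrite -natrD !natr1 !pnatr_eq0.
Qed.

(** Three nested inductions, on [l], on [k] and downwards on [r]: the recurrence reaches a threshold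
    from a smaller [l], a smaller [k] or a larger [r]. *)
Lemma nfamE N r l k : (l.+1 < N)%N -> (r <= l.+1)%N ->
  (nfam N r l.+1 k)%:R = nfam_formula r l k.
Proof.
elim: l k r => [|l IHl] k r lN rl.
  case: k => [|k].
    by rewrite nfam0 // rl /nfam_formula !bin0 mulr0 addr0 !mulr1.
  rewrite nfam1 // /nfam_formula; case: r rl => [|[|//]] _; last by rewrite bin0n !mul0r.
  (* For [r = 0] and a single chord the binomials do not vanish, but the linear factor
     [1 + (0 - 1) * 1] does. *)
  by case: k => [|k]; [rewrite mulr1 sub0r subrr mulr0 mul0r | rewrite bin_small // !mul0r].
elim: k r rl => [|k IHk] r rl.
  by rewrite nfam0 // rl /nfam_formula !bin0 mulr0 addr0 !mulr1 !mul1r divff // pnatr_eq0.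
have [j] := ubnP (l.+2 - r)%N; elim: j r rl => // j IHj r rl jr.
have [->|rl'] := eqVneq r l.+2; first by rewrite nfam_top // /nfam_formula subnn bin0n !mul0r.
have main r' : (r' <= l)%N -> r = r'.+1 -> (nfam N r l.+2 k.+1)%:R = nfam_formula r l.+1 k.+1.
  move=> rl1 E; subst r; apply: (addIr (nfam_formula r'.+1 l k.+1)).
  rewrite nfam_formula_rec // -!IHl -?IHk -?IHj -?natrD ?nfam_rec //; lia.
(* The recurrence needs a positive threshold; [r = 0] is reduced to [r = 1]. *)
case: r rl jr rl' main => [|r] rl jr rl' main; last by apply: (main r) => //; lia.
by rewrite nfam_eq01 ?nfam_formula01 // IHj //; lia.
Qed.

(** For [r = 2] and [l = n - 1] the linear factor is [n + m]; divided by [n] it turns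
    ['C(n + m - 1, m)] into ['C(n + m, m)]. *)
Lemma nfam2E N n m : (2 <= n < N)%N ->
  (nfam N 2 n m)%:R = m.+1%:R^-1 * 'C(n - 2, m)%:R * 'C(n + m, m)%:R :> rat.
Proof.
case: n => // n /andP[n1 nN]; rewrite nfamE // /nfam_formula.
have h : 'C(n.+1 + m, m)%:R = (n.+1 + m)%:R / n.+1%:R * 'C(n + m, m)%:R :> rat.
  have : ((n.+1 + m - m) * 'C(n.+1 + m, m))%:R = ((n.+1 + m) * 'C((n.+1 + m).-1, m))%:R :> rat.
    by rewrite mul_bin_down.
  rewrite addnK /= !natrM => E; apply: (@mulfI _ n.+1%:R); first by rewrite pnatr_eq0.
  by rewrite E mulrA mulrCA divff ?pnatr_eq0 // mulr1 ?addSn.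
rewrite h natrD -(natr1 m) -!(natr1 n).
by field; rewrite !natr1 !pnatr_eq0.
Qed.

End ClosedForm.

Local Open Scope ring_scope.

(** * Orientation of triples and chords of a convex polygon *)

Lemma set2_eq (T : finType) (a b c d : T) :
  [set a; b] = [set c; d] -> (a = c /\ b = d) \/ (a = d /\ b = c).
Proof.
move=> E.
have ci : c \in [set a; b] by rewrite E set21.
have di : d \in [set a; b] by rewrite E set22.
have ai : a \in [set c; d] by rewrite -E set21.
have bi : b \in [set c; d] by rewrite -E set22.
case/set2P: ai => a_; case/set2P: bi => b_; subst; try by [left|right].
  by move: di; rewrite finset.setUid inE => /eqP->; left.
by move: ci; rewrite finset.setUid inE => /eqP->; left.
Qed.

Lemma orient_rot (R : realType) (a b c : 'rV[R]_2) : orient b c a = orient a b c.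
Proof. by rewrite /orient; ring. Qed.

Lemma orient_swap (R : realType) (a b c : 'rV[R]_2) : orient a c b = - orient a b c.
Proof. by rewrite /orient; ring. Qed.

(** The three-term Grassmann-Pluecker relation for the vectors from [o] to [a], [b], [c], [d]. *)
Lemma orient_Plucker (R : realType) (o a b c d : 'rV[R]_2) :
  orient o a c * orient o b d =
  orient o a b * orient o c d + orient o a d * orient o b c.
Proof. by rewrite /orient; ring. Qed.

Lemma orient_comb (R : realType) (a b c d : 'rV[R]_2) (t : R) :
  orient a b ((1 - t) *: c + t *: d) = (1 - t) * orient a b c + t * orient a b d.
Proof. by rewrite /orient !mxE; ring. Qed.

Lemma orient_aab (R : realType) (a b : 'rV[R]_2) : orient a b a = 0.
Proof. by rewrite /orient; ring. Qed.

Lemma orient_abb (R : realType) (a b : 'rV[R]_2) : orient a b b = 0.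
Proof. by rewrite /orient; ring. Qed.

Section Convex.
Variables (R : realType) (n : nat) (p : 'I_n.+1 -> 'rV[R]_2).
Hypotheses (n2 : (2 <= n)%N) (convp : convex_polygon p).

Local Notation q := (fun i : nat => p (inord i)).
(** Only its sign matters: multiplying by [s] treats both orientations of the boundary at once. *)
Let s := orient (q 0%N) (q 1%N) (q 2%N).

Lemma orient_edge (i j k : nat) : (i < n)%N -> (j <= n)%N -> (k <= n)%N ->
  j != i -> j != i.+1 -> k != i -> k != i.+1 ->
  0 < orient (q i) (q i.+1) (q j) * orient (q i) (q i.+1) (q k).
Proof.
move=> iN jN kN ji ji1 ki ki1.
have E : ordS (inord i : 'I_n.+1) = inord i.+1.
  by apply: val_inj; rewrite /= !inordK ?modn_small; lia.
rewrite -E; apply: convp; rewrite ?E -val_eqE /= !inordK; lia.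
Qed.

(** Convexity compares signs along one edge only. Consecutive edges share the triple
    [i, i + 1, i + 2], which carries the sign from one edge to the next. *)
Lemma orient_edge_sign (i j : nat) : (i < n)%N -> (j <= n)%N ->
  j != i -> j != i.+1 -> 0 < s * orient (q i) (q i.+1) (q j).
Proof.
elim: i j => [|i IH] j iN jN ji ji1; first by apply: orient_edge; lia.
have := IH i.+2 (ltnW iN) iN; rewrite -orient_rot => /(_ _ _) h.
have {}h : 0 < s * orient (q i.+1) (q i.+2) (q i) by apply: h; lia.
have h2 : 0 < orient (q i.+1) (q i.+2) (q i) * orient (q i.+1) (q i.+2) (q j).
  by apply: orient_edge; lia.
have := mulr_gt0 h h2.
(* The shared triple occurs squared and is nonzero by [h], so it can be cancelled. *)
rewrite [X in 0 < X](_ : _ = (orient (q i.+1) (q i.+2) (q i)) ^+ 2 *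
  (s * orient (q i.+1) (q i.+2) (q j))); last by ring.
rewrite pmulr_rgt0 // lt_neqAle sqr_ge0 eq_sym sqrf_eq0 andbT.
by apply: contraTneq h => ->; rewrite mulr0 ltxx.
Qed.

(** Induction on [k]: the Pluecker relation at [i] for [i + 1], [j], [k], [k + 1] expresses the new
    triple through triples containing an edge and the triple [i, j, k]. *)
Lemma orient_triple (i j k : nat) : (i < j < k)%N -> (k <= n)%N ->
  0 < s * orient (q i) (q j) (q k).
Proof.
elim: k => [|k IH] /andP[ij jk] kn; first by [].
have [->|ji] := eqVneq j i.+1; first by apply: orient_edge_sign; lia.
have e1 : 0 < s * orient (q i) (q i.+1) (q j) by apply: orient_edge_sign; lia.
have e2 : 0 < s * orient (q i) (q k) (q k.+1).
  by rewrite -orient_rot; apply: orient_edge_sign; lia.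
have [->//|jk'] := eqVneq j k.
have e3 : 0 < s * orient (q i) (q i.+1) (q k.+1) by apply: orient_edge_sign; lia.
have e4 : 0 < s * orient (q i) (q i.+1) (q k) by apply: orient_edge_sign; lia.
have e5 : 0 < s * orient (q i) (q j) (q k) by apply: IH; lia.
rewrite -(pmulr_rgt0 _ e4).
have -> : s * orient (q i) (q i.+1) (q k) * (s * orient (q i) (q j) (q k.+1)) =
  (s * orient (q i) (q i.+1) (q j)) * (s * orient (q i) (q k) (q k.+1)) +
  (s * orient (q i) (q i.+1) (q k.+1)) * (s * orient (q i) (q j) (q k)).
  have P := orient_Plucker (q i) (q i.+1) (q j) (q k) (q k.+1).
  transitivity (s ^+ 2 * (orient (q i) (q i.+1) (q k) * orient (q i) (q j) (q k.+1))).
    by ring.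
  by rewrite P; ring.
by rewrite addr_gt0 // mulr_gt0.
Qed.

Lemma orient_ord (i j k : 'I_n.+1) : (i < j < k)%N -> 0 < s * orient (p i) (p j) (p k).
Proof.
move=> ijk; have := @orient_triple i j k ijk.
by rewrite !inord_val; apply; rewrite -ltnS.
Qed.

(** An unordered pair determines its ends up to a swap, which replaces [t] by [1 - t]. *)
Lemma diagonal_interior2 (a b : 'I_n.+1) (x : 'rV[R]_2) :
  diagonal_interior p [set a; b]%SET x <->
  exists2 t : R, 0 < t < 1 & x = (1 - t) *: p a + t *: p b.
Proof.
split=> [[i [j [t [E /andP[t0 t1] ->]]]]|[t t01 ->]]; last by exists a, b, t.
have [[-> ->]|[-> ->]] := set2_eq E; first by exists t => //; rewrite t0.
exists (1 - t); first lra.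
by rewrite addrC; congr (_ *: _ + _); ring.
Qed.

(** The meeting point is explicit: each diagonal of the quadrilateral [a, c, b, d] is divided in the
    ratio of the areas of the triangles that the other cuts off at its ends. *)
Lemma crossing_meet (a b c d : 'I_n.+1) : (a < c < b)%N -> (b < d)%N ->
  (diagonal_interior p [set a; b]%SET `&` diagonal_interior p [set c; d]%SET !=set0)%classic.
Proof.
move=> acb bd.
have hC : 0 < s * orient (p a) (p c) (p b) by apply: orient_ord.
have hD : 0 < s * orient (p a) (p b) (p d) by apply: orient_ord; lia.
have hA : 0 < s * orient (p a) (p c) (p d) by apply: orient_ord; lia.
have hB : 0 < s * orient (p c) (p b) (p d) by apply: orient_ord; lia.
set oC := orient (p a) (p c) (p b) in hC.
set oD := orient (p a) (p b) (p d) in hD.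
set oA := orient (p a) (p c) (p d) in hA.
set oB := orient (p c) (p b) (p d) in hB.
(* Both sums are twice the signed area of the quadrilateral. *)
have sum : oC + oD = oA + oB by rewrite /oC /oD /oA /oB /orient; ring.
have frac x y : 0 < s * x -> 0 < s * y -> 0 < x / (x + y) < 1.
  move=> hx hy; have hxy : 0 < s * (x + y) by rewrite mulrDr addr_gt0.
  have s0 : s != 0 by apply: contraTneq hx => ->; rewrite mul0r ltxx.
  have xy0 : x + y != 0 by apply: contraTneq hxy => ->; rewrite mulr0 ltxx.
  have -> : x / (x + y) = (s * x) / (s * (x + y)) by field; rewrite s0 xy0.
  by rewrite divr_gt0 //= ltr_pdivrMr // mul1r mulrDr ltrDl.
have n0 : oC + oD != 0.
  by apply: contraTneq (addr_gt0 hC hD) => h; rewrite -mulrDr h mulr0 ltxx.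
exists ((1 - oC / (oC + oD)) *: p c + (oC / (oC + oD)) *: p d); split; apply/diagonal_interior2.
  exists (oA / (oA + oB)); first exact: frac.
  rewrite -sum; apply/rowP => i; rewrite !mxE.
  have nz := n0; rewrite /oC /oD /orient in nz.
  have [->|->] : i = 0 \/ i = 1.
    by case: i => -[|[|m]] im; [left|right|]; first [exact/val_inj|by []].
    by rewrite /oA /oC /oD /orient; field.
  by rewrite /oA /oC /oD /orient; field.
by exists (oC / (oC + oD)) => //; exact: frac.
Qed.

(** [L] tells the side of the line through [a] and [b]: negative strictly between them, positive
    outside, zero at both. A common point makes a strictly positive combination of [L c] and [L d]
    vanish, but without interleaving these never have opposite signs, and they are not both zero. *)
Lemma noncrossing_disjoint (a b c d : 'I_n.+1) : (a < b)%N -> (c < d)%N ->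
  (a != c) || (b != d) ->
  ~~ ((a < c < b) && (b < d))%N -> ~~ ((c < a < d) && (d < b))%N ->
  (diagonal_interior p [set a; b]%SET `&` diagonal_interior p [set c; d]%SET
   = classical_sets.set0)%classic.
Proof.
move=> ab cd neq n1 n2'; rewrite -classical_sets.subset0 => x.
case=> /diagonal_interior2[t t01 xt] /diagonal_interior2[u u01 xu].
pose L v := s * orient (p a) (p b) (p v).
have L0 : (1 - u) * L c + u * L d = 0.
  have : s * orient (p a) (p b) x = s * orient (p a) (p b) x by [].
  rewrite {1}xt xu !orient_comb orient_aab orient_abb /L => h.
  transitivity (s * ((1 - u) * orient (p a) (p b) (p c) + u * orient (p a) (p b) (p d))).
    by ring.
  by rewrite -h; ring.
have Lout (v : 'I_n.+1) : (v < a)%N || (b < v)%N -> 0 < L v.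
  case/orP => h; last by apply: orient_ord; lia.
  by rewrite /L orient_rot; apply: orient_ord; lia.
have Lin (v : 'I_n.+1) : (a < v < b)%N -> L v < 0.
  by move=> h; rewrite /L orient_swap mulrN oppr_lt0; apply: orient_ord.
have La : L a = 0 by rewrite /L orient_aab mulr0.
have Lb : L b = 0 by rewrite /L orient_abb mulr0.
have [u0 u1] := andP u01.
clearbody L; have u1' : 0 < 1 - u by rewrite subr_gt0.
have contra_pos : 0 <= L c -> 0 <= L d -> (0 < L c) || (0 < L d) -> False.
  move=> c0 d0 /orP[h|h].
    by have := mulr_gt0 u1' h; have := mulr_ge0 (ltW u0) d0; lra.
  by have := mulr_gt0 u0 h; have := mulr_ge0 (ltW u1') c0; lra.
have contra_neg : L c <= 0 -> L d <= 0 -> (L c < 0) || (L d < 0) -> False.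
  move=> c0 d0 /orP[h|h].
    have : (1 - u) * L c < 0 by rewrite pmulr_rlt0.
    by have : u * L d <= 0 by [rewrite pmulr_rle0]; lra.
  have : u * L d < 0 by rewrite pmulr_rlt0.
  by have : (1 - u) * L c <= 0 by [rewrite pmulr_rle0]; lra.
have [cin|cout] := boolP (a < c < b)%N.
  apply: contra_neg; [exact/ltW/Lin| |by rewrite Lin].
  have [->|db] := eqVneq d b; first by rewrite Lb.
  by apply/ltW/Lin; move: n1 cin cd db; rewrite -val_eqE /=; clear; lia.
have [din|dout] := boolP (a < d < b)%N.
  have ca : c = a by apply: val_inj => /=; move: cd n2' cout din; clear; lia.
  by apply: contra_neg; [rewrite ca La|exact/ltW/Lin|rewrite (Lin d) ?orbT].
have Lge (v : 'I_n.+1) : ~~ (a < v < b)%N -> v = a \/ v = b \/ 0 < L v.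
  move=> vout; have [->|va] := eqVneq v a; first by left.
  have [->|vb] := eqVneq v b; first by right; left.
  by right; right; apply: Lout; move: vout va vb; rewrite -!val_eqE /=; clear; lia.
have [ca|[cb|Lc]] := Lge c cout; have [da|[db|Ld]] := Lge d dout.
all: try by apply: contra_pos; rewrite ?ca ?cb ?da ?db ?La ?Lb ?Lc ?Ld ?orbT // ltW.
(* Here [c] and [d] both lie in [{a, b}]; with [c < d] this would make the two chords equal. *)
all: exfalso; move: neq cd ab; subst; rewrite ?eqxx ?ltnn -?leqNgt //; clear; lia.
Qed.

Lemma disjoint_interiors (c d : 'I_n.+1 * 'I_n.+1) :
  (c.1 < c.2)%N -> (d.1 < d.2)%N -> c != d ->
  `[< (diagonal_interior p [set c.1; c.2]%SET `&` diagonal_interior p [set d.1; d.2]%SET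
       = classical_sets.set0)%classic >] = ~~ crossing c d && ~~ crossing d c.
Proof.
case: c d => [a b] [c d] /= ab cd; rewrite xpair_eqE negb_and => neq.
apply/asboolP/andP => [h|[nabcd ncdab]]; last exact: noncrossing_disjoint.
split; apply/negP => /andP[/= h1 h2]; have /set0P/eqP := crossing_meet h1 h2; first exact.
by rewrite classical_sets.setIC.
Qed.
End Convex.

(** * From dissections to noncrossing chord sets *)

Section Count.
Variable n : nat.
Hypothesis n2 : (2 <= n)%N.
Local Notation chord := ('I_n.+1 * 'I_n.+1)%type.

Definition ends (c : chord) : {set 'I_n.+1} := [set c.1; c.2].

Lemma ends_inj (c d : chord) : (c.1 < c.2)%N -> (d.1 < d.2)%N -> ends c = ends d -> c = d.
Proof.
case: c d => [a b] [c d] /= ab cd /set2_eq /= [[-> ->]//|[ac bd]].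
by subst; move: ab cd; lia.
Qed.

Lemma ordS_lt (i : 'I_n.+1) : val (ordS i) = (if i == n :> nat then 0 else i.+1)%N.
Proof.
have := ltn_ord i; rewrite /= ltnS leq_eqVlt; case: eqP => [->|_] //= h; first by rewrite modnn.
by rewrite modn_small.
Qed.

Lemma adjacent_lt (i j : 'I_n.+1) : (i < j)%N ->
  adjacent i j = (j == i.+1 :> nat) || ((i == 0 :> nat) && (j == n :> nat)).
Proof.
move=> ij; have := ltn_ord j; have := ltn_ord i.
rewrite /adjacent -!val_eqE !ordS_lt /=.
by case: ifP; case: ifP; lia.
Qed.

(** Among pairs at distance at least two, only the wrap-around side from [0] to [n] fails to be a
    diagonal. *)
Lemma ends_diagonals (c : chord) : (c.1 < c.2)%N ->
  (ends c \in diagonals n.+1) = (c.1.+1 < c.2)%N && (c != (ord0, ord_max)).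
Proof.
case: c => i j /= ij.
have -> : (ends (i, j) \in diagonals n.+1) = ~~ adjacent i j.
  rewrite inE; apply/existsP/idP => [[a /existsP[b /and3P[ab nab /eqP /set2_eq /=]]]|nij].
    by case=> -[-> ->] //; rewrite /adjacent orbC.
  by exists i; apply/existsP; exists j; rewrite nij eqxx andbT -val_eqE /= ltn_eqF.
rewrite adjacent_lt // xpair_eqE -!val_eqE /=; move: ij; clear; lia.
Qed.

(** Vertices [0] and [n] are always visible. The base chord hides all others; without it,
    [visible_between] starting from [0] supplies a third visible vertex. *)
Lemma noncrossing_base (S : {set chord}) : noncrossing n S ->
  (2 < #|visibles n S|)%N = ((ord0, ord_max) \notin S).
Proof.
move=> nc; have [inS|ninS] := boolP (_ \in S); apply/idP => /=.
  apply/negP; rewrite -leqNgt.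
  have /subset_leq_card : visibles n S \subset [set ord0; ord_max].
    apply/subsetP => v; rewrite !inE => /andP[_ /visibleP/(_ _ inS)].
    by have := ltn_ord v; rewrite -!val_eqE /=; lia.
  by move/leq_trans; apply; rewrite cards2; case: (_ != _).
have [v vv /andP[v0 vn]] := visible_between nc (erefl : ord_max = n :> nat)
  (visible0 S (erefl : ord0 = 0%N :> nat)) n2 ninS.
apply: (@leq_trans #|v |: [set ord0; ord_max]|).
  rewrite cardsU1 cards2 !inE -!val_eqE /=; move: v0 vn n2; clear; lia.
apply: subset_leq_card; apply/subsetP => w; rewrite !inE => /or3P[] /eqP->.
- by rewrite vv ltnW.
- by rewrite visible0.
by rewrite (visible_end nc) // leqnn.
Qed.

Variables (R : realType) (p : 'I_n.+1 -> 'rV[R]_2).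
Hypothesis convp : convex_polygon p.

(** Ordering the ends of each diagonal identifies dissections with the images under [ends] of
    noncrossing chord sets that avoid the base side. *)
Lemma card_dissections m : #|dissections p m| = nfam n.+1 2 n m.
Proof.
set T := [set S in families n.+1 n m | (2 < #|visibles n S|)%N].
have TP S : S \in T -> [/\ noncrossing n S, #|S| = m & (ord0, ord_max) \notin S].
  by rewrite !inE => /andP[/andP[nc /eqP cS]]; rewrite noncrossing_base.
have Tlt S c : S \in T -> c \in S -> (c.1.+1 < c.2)%N.
  by case/TP => /noncrossingP[h _] _ _ /h /andP[].
have endsT S : S \in T -> {in S &, injective ends}.
  by move=> ST c d /(Tlt _ _ ST) cl /(Tlt _ _ ST) dl; apply: ends_inj; exact: ltnW.
have -> : dissections p m = [set ends @: (S : {set chord}) | S in T].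
  apply/setP => D; apply/idP/imsetP => [|[S ST ->]].
    rewrite inE => /and3P[/subsetP sub /eqP cD /forall_inP disj].
    pose S := [set c : chord | (c.1 < c.2)%N && (ends c \in D)].
    have DE : D = ends @: S.
      apply/setP => d; apply/idP/imsetP => [dD|[c]]; last by rewrite inE => /andP[_ h ->].
      have := sub _ dD; rewrite inE => /existsP[i /existsP[j /and3P[ij _ /eqP dE]]].
      have [h|h|/val_inj h] := ltngtP i j; last by rewrite h eqxx in ij.
        by exists (i, j) => //; rewrite inE /= h /ends /= -dE.
      have dE' : d = ends (j, i) by rewrite dE /ends /= finset.setUC.
      by exists (j, i) => //; rewrite inE /= h -dE'.
    have Sinj : {in S &, injective ends}.
      by move=> c d; rewrite !inE => /andP[cl _] /andP[dl _]; exact: ends_inj.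
    have Sdiag c : c \in S -> (c.1.+1 < c.2)%N && (c != (ord0, ord_max)).
      by rewrite inE => /andP[cl /sub]; rewrite ends_diagonals.
    have nc : noncrossing n S.
      apply/noncrossingP; split=> [c /Sdiag/andP[-> _]|c d cS dS].
        by rewrite /= -ltnS ltn_ord.
      have [->|cd] := eqVneq c d; first by rewrite /crossing ltnn.
      have [cl cD'] : (c.1 < c.2)%N /\ ends c \in D by move: cS; rewrite inE => /andP.
      have [dl dD] : (d.1 < d.2)%N /\ ends d \in D by move: dS; rewrite inE => /andP.
      have := forall_inP (disj _ cD') _ dD; rewrite (inj_in_eq Sinj) // cd /=.
      by rewrite disjoint_interiors // => /andP[].
    exists S => //; rewrite !inE nc noncrossing_base // -cD DE card_in_imset // eqxx /=.
    by apply/negP => /Sdiag; rewrite eqxx andbF.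
  have [nc cS bS] := TP _ ST; rewrite inE card_in_imset ?cS ?eqxx /=; last exact: endsT.
  apply/andP; split.
    apply/subsetP => _ /imsetP[c cin ->]; rewrite ends_diagonals; last exact/ltnW/(Tlt _ _ ST).
    by rewrite (Tlt _ _ ST) //; apply: contraNneq bS => <-.
  apply/forall_inP => _ /imsetP[c cin ->]; apply/forall_inP => _ /imsetP[d din ->].
  apply/implyP => cd; have {}cd : c != d by apply: contraNneq cd => ->.
  have [_ nc2] := noncrossingP _ _ nc.
  rewrite disjoint_interiors ?nc2 //; exact/ltnW/(Tlt _ _ ST).
(* [ends] separates only increasing pairs, so injectivity is shown on [T] alone. *)
apply: card_in_imset => S1 S2 S1T S2T E.
have sub S S' : S \in T -> S' \in T -> ends @: S = ends @: S' -> S \subset S'.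
  move=> ST S'T E'; apply/subsetP => c cS.
  have := imset_f ends cS; rewrite E' => /imsetP[d dS' /ends_inj ->] //.
    exact/ltnW/(Tlt _ _ ST).
  exact/ltnW/(Tlt _ _ S'T).
by apply/eqP; rewrite eqEsubset !sub.
Qed.

End Count.

Theorem corollary4p1 (R : realType) (n k : nat) (p : 'I_n.+1 -> 'rV[R]_2) :
  (2 <= n)%N -> (1 <= k <= n - 1)%N -> convex_polygon p ->
  #|dissections p (k - 1)|%:R =
    k%:R^-1 * 'C(n - 2, k - 1)%:R * 'C(n + k - 1, k - 1)%:R :> rat.
Proof.
move=> n2 /andP[k1 _] convp; rewrite card_dissections // nfam2E; last by rewrite n2 /=.
by rewrite subn1 prednK // -addnBA // subn1.
Qed.
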